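(* Let $U$ be a unital of order $q$ in $\mathcal{NP}$ containing $(0,1,0)$ and $(0,0,1)$, such that the tangent line of $U$ at $(0,0,1)$ passes through $(1,0,0)$. Let $G=\mathrm{Aut}(U)\cap\mathfrak L$, $G_1=G\cap\hat{\mathfrak R}_0$, $C=\{c:\phi(c,d,0,0)\in G_1\text{ for some }d\}$, and let $\delta:C\to\mathbb{F}_{q^2}^*$ be given by $\delta(c)=d$ whenever $\phi(c,d,0,0)\in G_1$ (well defined). Assume $o(G)=q(q^2-1)$. (i) If $\delta(x)=x^{j(q+1)}$ for all $x\in C$, for a positive integer $j$, then $U$ is projectively equivalent to $$\mathcal U(j)=\{(x,\mathrm{Nm}(x)^j+t\epsilon,1):x\in\mathbb{F}_{q^2},\ t\in\mathbb{F}_q\}\cup\{(0,1,0)\}.$$ (ii) If $\delta(x)=x^{j(q+1)/2}$ for all nonzero squares $x$ of $\mathbb{F}_{q^2}$, for a positive integer $j$, then $U$ is projectively equivalent to a unital containing $$\mathcal V(j)=\{(x,x^{j(q+1)/2}+t\epsilon,1):x\text{ a nonzero square of }\mathbb{F}_{q^2},\ t\in\mathbb{F}_q\}.$$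
   Context: Let $p$ be an odd prime, $q=p^e$, $\mathrm{Nm}(z)=z^{q+1}$. Fix a primitive element $\xi$ of $\mathbb{F}_{q^2}$ and put $\epsilon=\xi^{(q+1)/2}$ (so $\epsilon^q=-\epsilon$). The regular nearfield $\mathcal N(2,q)$ has underlying set $\mathbb{F}_{q^2}$, field addition, and multiplication $x\star y=xy$ if $y$ is a nonzero square of $\mathbb{F}_{q^2}$, $x\star y=x^qy$ if $y$ is a nonsquare, $x\star0=0$. The plane $\mathcal{NP}$ has points $(x,y,1)$ ($x,y\in\mathbb{F}_{q^2}$), $(1,y,0)$, $(0,1,0)$; lines $[s,1,t]$, $[1,0,t]$, $[0,0,1]$; $(x,y,z)$ lies on $[s,u,t]$ iff $x\star s+y\star u+z\star t=0$. $\phi(c,d,u,v)$ ($c,d\ne0$) is the collineation acting on affine points by $(x,y,1)\mapsto(x\star c+u,y\star d+v,1)$, $\gamma(c,d,u,v)$ the one acting by $(x,y,1)\mapsto(y\star c+u,x\star d+v,1)$; $\hat{\mathfrak R}_0=\{\phi(c,d,0,0)\}$, $\mathfrak L=\{\phi(c,d,u,v)\}\cup\{\gamma(c,d,u,v)\}$. A unital of order $q$ is a set of $q^3+1$ points meeting every line in $1$ (tangent) or $q+1$ (secant) points; $\mathrm{Aut}(U)$ is the group of collineations preserving $U$. Two point sets are projectively equivalent if one is the image of the other under a collineation of $\mathcal{NP}$. *)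

(* Defs.v *)
(* The plane over the regular nearfield N(2, q), whose
   underlying field F has q ^ 2 elements; q is passed explicitly since the
   nearfield multiplication involves the map x |-> x ^+ q. *)
From HB Require Import structures.
From mathcomp Require Import all_boot all_order all_algebra all_fingroup.

Set Implicit Arguments.
Unset Strict Implicit.
Unset Printing Implicit Defensive.

Import GRing.Theory.
Local Open Scope ring_scope.

(* (x, y, 1), (1, y, 0) and (0, 1, 0) *)
Inductive np_point (F : Type) :=
  PtAff of F & F | PtInf of F | PtVert.

(* [s, 1, t], [1, 0, t] and [0, 0, 1] *)
Inductive np_line (F : Type) :=
  LnGen of F & F | LnVert of F | LnInf.

Arguments PtVert {F}.
Arguments LnInf {F}.

Section Finiteness.
Variable F : Type.

Definition point_code (P : np_point F) : F * F + option F :=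
  match P with
  | PtAff x y => inl (x, y) | PtInf y => inr (Some y) | PtVert => inr None
  end.
Definition point_decode (c : F * F + option F) : np_point F :=
  match c with
  | inl (x, y) => PtAff x y | inr (Some y) => PtInf y | inr None => PtVert
  end.
Lemma point_codeK : cancel point_code point_decode.
Proof. by case. Qed.

Definition line_code (l : np_line F) : F * F + option F :=
  match l with
  | LnGen s t => inl (s, t) | LnVert t => inr (Some t) | LnInf => inr None
  end.
Definition line_decode (c : F * F + option F) : np_line F :=
  match c with
  | inl (s, t) => LnGen s t | inr (Some t) => LnVert t | inr None => LnInf
  end.
Lemma line_codeK : cancel line_code line_decode.
Proof. by case. Qed.

End Finiteness.

HB.instance Definition _ (F : finType) :=
  Finite.copy (np_point F) (can_type (@point_codeK F)).
HB.instance Definition _ (F : finType) :=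
  Finite.copy (np_line F) (can_type (@line_codeK F)).

Section Plane.
Variables (F : finFieldType) (q : nat).
Implicit Types (x y c d u v s t : F) (P : np_point F) (l : np_line F).
Implicit Types (U : {set np_point F}) (f : {perm np_point F}).

Definition is_square x : bool := [exists z : F, x == z ^+ 2].

Definition nf_mul x y : F :=
  if y == 0 then 0 else if is_square y then x * y else x ^+ q * y.

Definition point_coord P : F * F * F :=
  match P with
  | PtAff x y => (x, y, 1) | PtInf y => (1, y, 0) | PtVert => (0, 1, 0)
  end.
Definition line_coord l : F * F * F :=
  match l with
  | LnGen s t => (s, 1, t) | LnVert t => (1, 0, t) | LnInf => (0, 0, 1)
  end.

Definition incident P l : bool :=
  let: (x, y, z) := point_coord P in
  let: (s, u, t) := line_coord l in
  nf_mul x s + nf_mul y u + nf_mul z t == 0.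

Definition line_points l : {set np_point F} := [set P | incident P l].

Definition collineations : {set {perm np_point F}} :=
  [set f : {perm np_point F} | [forall l, exists m, f @: line_points l == line_points m]].

Definition proj_equiv U1 U2 : Prop :=
  exists2 f, f \in collineations & f @: U1 = U2.

(* A collineation is determined by its action on the affine points, so at most
   one f satisfies is_phi (resp. is_gamma) for given c, d, u, v. *)
Definition is_phi c d u v f : bool :=
  [&& c != 0, d != 0, f \in collineations &
      [forall x, forall y,
         f (PtAff x y) == PtAff (nf_mul x c + u) (nf_mul y d + v)]].
Definition is_gamma c d u v f : bool :=
  [&& c != 0, d != 0, f \in collineations &
      [forall x, forall y,
         f (PtAff x y) == PtAff (nf_mul y c + u) (nf_mul x d + v)]].

Definition R0hat : {set {perm np_point F}} :=
  [set f : {perm np_point F} | [exists c, exists d, is_phi c d 0 0 f]].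
Definition Lgrp : {set {perm np_point F}} :=
  [set f : {perm np_point F} | [exists c, exists d, exists u, exists v, is_phi c d u v f]] :|:
  [set f : {perm np_point F} | [exists c, exists d, exists u, exists v, is_gamma c d u v f]].

Definition is_unital U : Prop :=
  #|U| = (q ^ 3).+1 /\
  forall l, #|U :&: line_points l| = 1%N \/ #|U :&: line_points l| = q.+1.

Definition tangent_at U P l : Prop :=
  [/\ P \in U, incident P l & #|U :&: line_points l| = 1%N].

Definition AutU U : {set {perm np_point F}} :=
  [set f in collineations | f @: U == U].

Definition grpG U : {set {perm np_point F}} := AutU U :&: Lgrp.
Definition grpG1 U : {set {perm np_point F}} := grpG U :&: R0hat.

Definition phi_in_G1 U c d : bool := [exists f in grpG1 U, is_phi c d 0 0 f].

Definition domC U : {set F} := [set c | [exists d, phi_in_G1 U c d]].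

(* For the unitals considered d is unique: if phi(1, d, 0, 0) preserves U, then
   on a secant x = a with a != 0 its orbits on the q affine points of U all have
   as length the order of d, which thus divides both q and q ^ 2 - 1, so that
   d = 1.  The value outside domC U is the junk value 0. *)
Definition delta U c : F := odflt 0 [pick d | phi_in_G1 U c d].

Definition Nm x : F := x ^+ q.+1.
Definition Fq : {set F} := [set t | t ^+ q == t].

Definition unitalU (eps : F) (j : nat) : {set np_point F} :=
  [set PtAff x (Nm x ^+ j + t * eps) | x : F, t : F in Fq] :|: [set PtVert].

Definition setV (eps : F) (j : nat) : {set np_point F} :=
  [set PtAff x (x ^+ (j * (q.+1)./2) + t * eps)
     | x in [pred x : F | (x != 0) && is_square x], t in Fq].

End Plane.

(* Main.v *)
(* Since (1,0,0) is not in U, no gamma preserves U, so G consists of maps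
   phi(c,d,u,v).  The translations (c = d = 1) in G form its Sylow p-subgroup, of
   order q.  One moving both coordinates would have too large a conjugacy class,
   and one moving only x contradicts the tangent y = 0; so they are the maps
   y |-> y + v for v in V = {v : (0,v,1) in U}, the line at infinity is a tangent,
   and every line x = a meets the affine part of U in a coset of V.  An orbit-sum
   argument shows that c determines an element of G up to translations, so all
   c <> 0 occur; looking at c = -1, all u vanish.  Hence (1,b,1) in U gives
   (x, b * delta(x) + v, 1) in U.  Counting points of U on y = b gives
   gcd(j', q - 1) <= 2, where delta(x) = x^(j'(q+1)/2) on squares (j' = 2j in (i));
   hence V is invariant under the squares of F_q, which span F_q, so V = w F_q.
   A map y |-> y * d then takes V to eps F_q and b into 1 + eps F_q. *)
Require Import Defs.
From mathcomp Require Import all_boot all_order all_algebra all_fingroup.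
From mathcomp Require Import cyclic pgroup sylow finfield.
From mathcomp Require Import ring zify.

Set Implicit Arguments.
Unset Strict Implicit.
Unset Printing Implicit Defensive.

Import GRing.Theory.
Local Open Scope ring_scope.

(** * The regular nearfield *)

Section NearfieldPlane.

Variables (p e q : nat).
Hypotheses (p_prime : prime p) (p_odd : odd p).
Hypotheses (e_gt0 : (0 < e)%N) (q_def : q = (p ^ e)%N).
Variable F : finFieldType.
Hypothesis cardF : #|F| = (q ^ 2)%N.
Variable xi : F.
Hypothesis xi_prim : ((q ^ 2).-1).-primitive_root xi.

Local Notation "x ** y" := (nf_mul q x y) (at level 40, left associativity).
Implicit Types a b c d s t u v w x y z : F.

Lemma odd_q : odd q.
Proof. by rewrite q_def oddX p_odd orbT. Qed.

Lemma q_gt2 : (2 < q)%N.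
Proof.
have p_gt2 : (2 < p)%N by rewrite odd_prime_gt2.
by rewrite q_def (leq_trans p_gt2) // -{1}(expn1 p) leq_exp2l // (leq_trans _ p_gt2).
Qed.

Lemma predq2E : ((q ^ 2).-1 = q.-1 * q.+1)%N.
Proof. rewrite -mulnn; have := q_gt2; case: (q) => // r _; rewrite mulSn; lia. Qed.

Lemma halfq : ((q.+1)./2 * 2 = q.+1)%N.
Proof. by rewrite muln2 even_halfK //= odd_q. Qed.

Lemma even_predq2 : ~~ odd (q ^ 2).-1.
Proof. by rewrite predq2E oddM /= odd_q andbF. Qed.

Lemma charF : p \in [pchar F].
Proof. by apply: (@card_finPcharP F p (e * 2)) => //; rewrite cardF q_def expnM. Qed.

Lemma q_nat : [pchar F].-nat q.
Proof. by rewrite q_def pnatX (eq_pnat _ (pcharf_eq charF)) pnat_id. Qed.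

Lemma frobD x y : (x + y) ^+ q = x ^+ q + y ^+ q.
Proof. by rewrite exprDn_pchar // q_nat. Qed.

Lemma frobN x : (- x) ^+ q = - x ^+ q.
Proof. by rewrite exprNn -signr_odd odd_q mulN1r. Qed.

Lemma frobB x y : (x - y) ^+ q = x ^+ q - y ^+ q.
Proof. by rewrite frobD frobN. Qed.

Lemma frobK x : (x ^+ q) ^+ q = x.
Proof. by rewrite -exprM mulnn -cardF expf_card. Qed.

Lemma two_neq0 : 2%:R != 0 :> F.
Proof.
rewrite -(dvdn_pcharf charF).
by apply/negP => /(dvdn_leq (isT : (0 < 2)%N)); rewrite leqNgt odd_prime_gt2.
Qed.

Lemma q_natr : q%:R = 0 :> F.
Proof. by apply/eqP; rewrite -(dvdn_pcharf charF) q_def dvdn_exp. Qed.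

Lemma xi_neq0 : xi != 0.
Proof.
by rewrite (prim_root_eq0 xi_prim) -lt0n predq2E; have := q_gt2; lia.
Qed.

Lemma expf_predq2 x : x != 0 -> x ^+ (q ^ 2).-1 = 1.
Proof.
move=> x0; apply: (mulfI x0).
by rewrite mulr1 -exprS prednK ?expn_gt0 ?(ltn_trans _ q_gt2) // -cardF expf_card.
Qed.

Lemma xi_gen x : x != 0 -> exists i, x = xi ^+ i.
Proof. by move=> /expf_predq2 /(prim_rootP xi_prim)[i ->]; exists i. Qed.

Lemma is_squareX i : is_square (xi ^+ i) = ~~ odd i.
Proof.
apply/existsP/idP => [[z /eqP zE]|ev].
- have z0 : z != 0.
    by apply/eqP => z0; move/eqP: zE; rewrite z0 expr0n expf_eq0 (negPf xi_neq0) andbF.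
  have [k kE] := xi_gen z0; move/eqP: zE; rewrite kE -exprM (eq_prim_root_expr xi_prim).
  move=> /eqP /(congr1 odd).
  by rewrite !odd_mod ?(negPf even_predq2) // => ->; rewrite muln2 odd_double.
- by exists (xi ^+ i./2); rewrite -exprM muln2 even_halfK.
Qed.

Lemma is_square0 : is_square (0 : F).
Proof. by apply/existsP; exists 0; rewrite expr0n. Qed.

Lemma is_square1 : is_square (1 : F).
Proof. by apply/existsP; exists 1; rewrite expr1n. Qed.

Lemma nf_mulE x y : x ** y = (if is_square y then x else x ^+ q) * y.
Proof.
rewrite /nf_mul; have [->|y0] := eqVneq y 0; first by rewrite mulr0.
by case: ifP.
Qed.

Lemma nf_mul0r y : 0 ** y = 0.
Proof. by rewrite nf_mulE expr0n; case: (q) q_gt2 => // n _; rewrite if_same mul0r. Qed.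

Lemma nf_mulr0 x : x ** 0 = 0.
Proof. by rewrite nf_mulE mulr0. Qed.

Lemma nf_mul1r y : 1 ** y = y.
Proof. by rewrite nf_mulE expr1n if_same mul1r. Qed.

Lemma nf_mulr1 x : x ** 1 = x.
Proof. by rewrite nf_mulE is_square1 mulr1. Qed.

Lemma nf_mulDl x y z : (x + y) ** z = x ** z + y ** z.
Proof. by rewrite !nf_mulE frobD; case: ifP; rewrite mulrDl. Qed.

Lemma nf_mulNl x z : (- x) ** z = - (x ** z).
Proof. by rewrite !nf_mulE frobN; case: ifP; rewrite mulNr. Qed.

Lemma nf_mulBl x y z : (x - y) ** z = x ** z - y ** z.
Proof. by rewrite nf_mulDl nf_mulNl. Qed.

Lemma nf_mul_eq0 x y : (x ** y == 0) = (x == 0) || (y == 0).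
Proof.
rewrite nf_mulE mulf_eq0; case: ifP => // _.
by rewrite expf_eq0; case: (q) q_gt2.
Qed.

Lemma is_square_nf_mul x y : x != 0 -> y != 0 ->
  is_square (x ** y) = (is_square x == is_square y).
Proof.
move=> /xi_gen[i ->] /xi_gen[k ->]; rewrite nf_mulE !is_squareX.
case: (boolP (odd k)) => ok /=; rewrite -?exprM -exprD is_squareX oddD ?oddM ?odd_q ?andbT;
  by rewrite ?ok ?(negPf ok); case: odd.
Qed.

Lemma nf_mulA x y z : x ** y ** z = x ** (y ** z).
Proof.
have [->|x0] := eqVneq x 0; first by rewrite !nf_mul0r.
have [->|y0] := eqVneq y 0; first by rewrite nf_mul0r nf_mulr0 nf_mul0r.
have [->|z0] := eqVneq z 0; first by rewrite !nf_mulr0.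
rewrite [RHS]nf_mulE is_square_nf_mul // !(nf_mulE _ z) nf_mulE.
case: (is_square z); case: (is_square y) => //=; rewrite ?mulrA ?exprMn_comm //;
  rewrite ?frobK //; exact: mulrC.
Qed.

Lemma nf_mulIr z x y : z != 0 -> x ** z = y ** z -> x = y.
Proof.
move=> z0 /eqP; rewrite -subr_eq0 -nf_mulBl nf_mul_eq0 (negPf z0) orbF subr_eq0.
by move/eqP.
Qed.

Lemma nf_mulIl x y z : x != 0 -> x ** y = x ** z -> y = z.
Proof.
move=> x0 E.
have [y0|y0] := eqVneq y 0.
  by move/eqP: E; rewrite y0 nf_mulr0 eq_sym nf_mul_eq0 (negPf x0) => /eqP.
have [z0|z0] := eqVneq z 0.
  by move/eqP: E; rewrite z0 nf_mulr0 nf_mul_eq0 (negPf x0) => /eqP.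
have S : is_square y = is_square z.
  by have := congr1 (@is_square F) E; rewrite !is_square_nf_mul //; do 3!case: is_square.
move: E; rewrite !nf_mulE S; apply: mulfI.
by case: ifP => //; rewrite expf_neq0.
Qed.

Lemma nf_divl x z : x != 0 -> exists y, x ** y = z.
Proof.
move=> x0; have inj : injective (nf_mul q x) by move=> y y'; exact: nf_mulIl.
by exists (invF inj z); exact: f_invF.
Qed.

Lemma nf_divr y z : y != 0 -> exists x, x ** y = z.
Proof.
move=> y0; have inj : injective (fun x => x ** y) by move=> x x'; exact: nf_mulIr.
by exists (invF inj z); exact: (f_invF inj).
Qed.

Lemma FqX x : (x \in Fq F q) = (x ^+ q == x).
Proof. by rewrite inE. Qed.

Lemma Fq_Nm x : x != 0 -> x \in Fq F q -> exists2 z, z != 0 & x = z ^+ q.+1.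
Proof.
move=> x0; rewrite FqX; have [i ->] := xi_gen x0.
rewrite -exprM (eq_prim_root_expr xi_prim) eqn_mod_dvd ?leq_pmulr //; last by have := q_gt2; lia.
rewrite -[X in (_ - X)%N]muln1 -mulnBr subn1 predq2E [(i * _)%N]mulnC dvdn_pmul2l;
  last by have := q_gt2; lia.
move=> /dvdnP[k ->]; exists (xi ^+ k); first by rewrite expf_neq0 ?xi_neq0.
by rewrite -exprM.
Qed.

Lemma Nm_Fq z : z ^+ q.+1 \in Fq F q.
Proof. by rewrite FqX -exprM mulnC exprM exprS frobK exprSr. Qed.

Lemma Fq_square x : x \in Fq F q -> is_square x.
Proof.
have [->|x0] := eqVneq x 0; first by rewrite is_square0.
move=> /(Fq_Nm x0)[z z0 ->]; have [i ->] := xi_gen z0.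
by rewrite -exprM is_squareX oddM /= odd_q andbF.
Qed.

Lemma Fq_mul x y : x \in Fq F q -> y \in Fq F q -> x * y \in Fq F q.
Proof. by rewrite !FqX exprMn => /eqP -> /eqP ->. Qed.

Lemma Fq_exp x n : x \in Fq F q -> x ^+ n \in Fq F q.
Proof. by rewrite !FqX -exprM mulnC exprM => /eqP ->. Qed.

Lemma Fq_add x y : x \in Fq F q -> y \in Fq F q -> x + y \in Fq F q.
Proof. by rewrite !FqX frobD => /eqP -> /eqP ->. Qed.

Lemma Fq_opp x : x \in Fq F q -> - x \in Fq F q.
Proof. by rewrite !FqX frobN => /eqP ->. Qed.

Lemma Fq_inv x : x \in Fq F q -> x^-1 \in Fq F q.
Proof. by rewrite !FqX exprVn => /eqP ->. Qed.

Lemma Fq1 : 1 \in Fq F q.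
Proof. by rewrite FqX expr1n. Qed.

Lemma nf_mul_Fq x y : y \in Fq F q -> x ** y = x * y.
Proof. by move=> /Fq_square Sy; rewrite nf_mulE Sy. Qed.

Lemma nf_mul_Fql x y z : x \in Fq F q -> (y * x) ** z = (y ** z) * x.
Proof.
rewrite FqX !nf_mulE exprMn => /eqP ->.
by case: ifP => _; rewrite mulrAC.
Qed.

Lemma card_Fq : (q <= #|Fq F q|)%N.
Proof.
have q2 := q_gt2.
pose f (i : 'I_q.-1) := xi ^+ (i * q.+1).
have f_inj : injective f.
  move=> i k /eqP; rewrite /f (eq_prim_root_expr xi_prim) predq2E -!muln_modl.
  by rewrite eqn_pmul2r // !modn_small // => /eqP /val_inj.
have : 0 |: [set f i | i : 'I_q.-1] \subset Fq F q.
  apply/subsetP => x /setU1P[->|/imsetP[i _ ->]].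
    by rewrite FqX expr0n; case: (q) q2.
  by rewrite /f exprM Nm_Fq.
move/subset_leq_card; rewrite cardsU1 card_imset // card_ord.
have -> : 0 \notin [set f i | i : 'I_q.-1].
  by apply/imsetP => -[i _ /esym/eqP]; rewrite /f expf_eq0 (negPf xi_neq0) andbF.
by rewrite add1n prednK // (ltn_trans _ q2).
Qed.

Variable eps : F.
Hypothesis eps_def : eps = xi ^+ (q.+1)./2.

Lemma eps_neq0 : eps != 0.
Proof. by rewrite eps_def expf_neq0 ?xi_neq0. Qed.

Lemma eps_frob : eps ^+ q = - eps.
Proof.
have q2 := q_gt2.
have E : eps ^+ q = eps ^+ q.-1 * eps by rewrite -exprSr prednK //; lia.
suff -> : eps ^+ q = - 1 * eps by rewrite mulN1r.
rewrite E; congr (_ * _); apply/eqP.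
have : (eps ^+ q.-1) ^+ 2 == 1.
  by rewrite -exprM eps_def -exprM mulnA mulnAC halfq mulnC -predq2E expf_predq2 ?xi_neq0.
rewrite sqrf_eq1 => /orP[|//].
rewrite eps_def -exprM -(prim_order_dvd xi_prim) predq2E.
rewrite [((q.+1)./2 * _)%N]mulnC dvdn_pmul2l; last by lia.
by have := halfq; move=> hq /dvdn_leq; lia.
Qed.

Lemma Fq_eps_decomp z :
  exists2 s, s \in Fq F q & exists2 t, t \in Fq F q & z = s + t * eps.
Proof.
have Fq2 : 2%:R \in Fq F q by rewrite -[2%:R]/(1 + 1) Fq_add ?Fq1.
exists ((z + z ^+ q) / 2%:R).
  rewrite Fq_mul ?Fq_inv // FqX frobD frobK addrC; exact: eqxx.
exists ((z - z ^+ q) / (2%:R * eps)).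
  rewrite FqX exprMn frobB frobK exprVn exprMn eps_frob.
  by move: Fq2; rewrite FqX => /eqP ->; rewrite mulrN invrN mulrN -mulNr opprB.
field; rewrite ?two_neq0 ?eps_neq0 //.
Qed.

(** * Lines and collineations *)

Implicit Types (P Q : np_point F) (l m : np_line F) (f g h : {perm np_point F}).

Lemma incident_aff_gen x y s t :
  incident q (PtAff x y) (LnGen s t) = (x ** s + y + t == 0).
Proof. by rewrite /incident /= nf_mulr1 nf_mul1r. Qed.

Lemma incident_aff_vert x y t : incident q (PtAff x y) (LnVert t) = (x + t == 0).
Proof. by rewrite /incident /= nf_mulr0 nf_mulr1 nf_mul1r addr0. Qed.

Lemma incident_aff_inf x y : incident q (PtAff x y) LnInf = false.
Proof. by rewrite /incident /= !nf_mulr0 nf_mul1r !add0r oner_eq0. Qed.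

Lemma incident_inf_gen n s t : incident q (PtInf n) (LnGen s t) = (s + n == 0).
Proof. by rewrite /incident /= nf_mul0r nf_mul1r nf_mulr1 addr0. Qed.

Lemma incident_inf_vert n t : incident q (PtInf n) (LnVert t) = false.
Proof. by rewrite /incident /= nf_mul0r nf_mulr1 nf_mulr0 !addr0 oner_eq0. Qed.

Lemma incident_inf_inf (n : F) : incident q (PtInf n) LnInf.
Proof. by rewrite /incident /= nf_mul0r !nf_mulr0 !addr0. Qed.

Lemma incident_vert_gen s t : incident q PtVert (LnGen s t) = false.
Proof. by rewrite /incident /= !nf_mul0r nf_mulr1 add0r addr0 oner_eq0. Qed.

Lemma incident_vert_vert t : incident q PtVert (LnVert t).
Proof. by rewrite /incident /= !nf_mul0r nf_mulr0 !addr0. Qed.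

Lemma incident_vert_inf : incident q (@PtVert F) LnInf.
Proof. by rewrite /incident /= !nf_mul0r nf_mulr0 !addr0. Qed.

Definition incidentE :=
  (incident_aff_gen, incident_aff_vert, incident_aff_inf, incident_inf_gen,
   incident_inf_vert, incident_inf_inf, incident_vert_gen, incident_vert_vert,
   incident_vert_inf).

Lemma eq_of_zeros x y z w : x = 0 -> y = 0 -> z - w = x - y -> z = w.
Proof. by move=> -> -> /eqP; rewrite subrr subr_eq0 => /eqP. Qed.

Definition is_aff P := if P is PtAff _ _ then true else false.

Lemma aff_line_uniq x y x' y' l m : PtAff x y != PtAff x' y' ->
  incident q (PtAff x y) l -> incident q (PtAff x' y') l ->
  incident q (PtAff x y) m -> incident q (PtAff x' y') m -> l = m.
Proof.
move=> neq.
have genP s t s' t' : incident q (PtAff x y) (LnGen s t) ->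
    incident q (PtAff x' y') (LnGen s t) -> incident q (PtAff x y) (LnGen s' t') ->
    incident q (PtAff x' y') (LnGen s' t') -> LnGen s t = LnGen s' t'.
  rewrite !incidentE => /eqP E1 /eqP E2 /eqP E3 /eqP E4.
  have D1 : (x - x') ** s = y' - y by rewrite nf_mulBl; apply: (eq_of_zeros E1 E2); ring.
  have D2 : (x - x') ** s' = y' - y by rewrite nf_mulBl; apply: (eq_of_zeros E3 E4); ring.
  have xx : x - x' != 0.
    apply: contra neq; rewrite subr_eq0 => /eqP xx; move: D1; rewrite xx subrr nf_mul0r.
    by move=> /esym/eqP; rewrite subr_eq0 => /eqP ->.
  have ss : s = s' by apply: (nf_mulIl xx); rewrite D1 D2.
  by congr LnGen => //; move: E1 E3; rewrite ss => E1 E3; apply: (eq_of_zeros E1 E3); ring.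
have mixP s t t' : incident q (PtAff x y) (LnGen s t) ->
    incident q (PtAff x' y') (LnGen s t) -> incident q (PtAff x y) (LnVert t') ->
    incident q (PtAff x' y') (LnVert t') -> False.
  rewrite !incidentE => /eqP E1 /eqP E2 /eqP E3 /eqP E4; case/eqP: neq.
  have xx : x = x' by apply: (eq_of_zeros E3 E4); ring.
  by congr PtAff => //; move: E1 E2; rewrite xx => E1 E2; apply: (eq_of_zeros E1 E2); ring.
case: l => [s t|t|]; case: m => [s' t'|t'|]; try by rewrite ?incident_aff_inf.
- exact: genP.
- by move=> H1 H2 H3 H4; case: (mixP _ _ _ H1 H2 H3 H4).
- by move=> H1 H2 H3 H4; case: (mixP _ _ _ H3 H4 H1 H2).
- by rewrite !incidentE => /eqP E1 _ /eqP E2 _; congr LnVert; apply: (eq_of_zeros E1 E2); ring.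
Qed.

Lemma inf_point_uniq P Q l : l != LnInf -> ~~ is_aff P -> ~~ is_aff Q ->
  incident q P l -> incident q Q l -> P = Q.
Proof.
case: l => [s t|t|]; case: P => [x y|n|]; case: Q => [x' y'|n'|] //; rewrite ?incidentE //.
by move=> _ _ _ /eqP E1 /eqP E2; congr PtInf; apply: (eq_of_zeros E1 E2); ring.
Qed.

Lemma collineationP f :
  reflect (forall l, exists m, forall P, incident q (f P) m = incident q P l)
          (f \in collineations F q).
Proof.
rewrite inE; apply: (iffP forallP) => H l.
- have /existsP[m /eqP E] := H l; exists m => P.
  have := mem_imset (line_points q l) P (@perm_inj _ f); rewrite E !inE => ->.
  by [].
- have [m E] := H l; apply/existsP; exists m; apply/eqP/setP => Q.
  by rewrite -(permKV f Q) (mem_imset _ _ (@perm_inj _ f)) !inE E.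
Qed.

Lemma line_points_inj l m : (forall P, incident q P l = incident q P m) -> l = m.
Proof.
move=> E.
case: l E => [s t|t|]; case: m => [s' t'|t'|] E //.
- have := E (PtInf (- s)); rewrite !incidentE subrr eqxx subr_eq0 => /esym/eqP ->.
  have := E (PtAff 0 (- t)); rewrite !incidentE nf_mul0r add0r addNr eqxx nf_mul0r add0r.
  by rewrite addrC subr_eq0 => /esym/eqP ->.
- by have := E PtVert; rewrite !incidentE.
- by have := E PtVert; rewrite !incidentE.
- by have := E PtVert; rewrite !incidentE.
- have := E (PtAff (- t) 0); rewrite !incidentE addNr eqxx addrC subr_eq0.
  by move=> /esym/eqP ->.
- by have := E (PtInf 0); rewrite !incidentE.
- by have := E PtVert; rewrite !incidentE.
- by have := E (PtInf 0); rewrite !incidentE.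
Qed.

Lemma collineation_preim f : f \in collineations F q ->
  forall m, exists l, forall P, incident q (f P) m = incident q P l.
Proof.
move=> /collineationP fc; pose P0 m l := [forall P, incident q (f P) m == incident q P l].
have ex l : exists m, P0 m l.
  by have [m E] := fc l; exists m; apply/forallP => P; rewrite E.
pose k l := xchoose (ex l).
have kP l P : incident q (f P) (k l) = incident q P l.
  by have /forallP/(_ P)/eqP := xchooseP (ex l).
have k_inj : injective k.
  by move=> l l' E; apply: line_points_inj => P; rewrite -(kP l) E kP.
move=> m; exists (invF k_inj m) => P.
by rewrite -[RHS]kP f_invF.
Qed.

Lemma unital_collineation f (U : {set np_point F}) :
  f \in collineations F q -> is_unital q U -> is_unital q (f @: U).
Proof.
move=> fc [cU lU]; split; first by rewrite card_imset //; exact: perm_inj.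
move=> m; have [l E] := collineation_preim fc m.
suff -> : f @: U :&: line_points q m = f @: (U :&: line_points q l).
  by rewrite card_imset; [exact: lU | exact: perm_inj].
apply/setP => Q; rewrite -(permKV f Q) inE !(mem_imset _ _ (@perm_inj _ f)) !inE.
by rewrite E.
Qed.

Lemma nonaff_stable f P :
  (forall a b, exists x y, f (PtAff x y) = PtAff a b) -> ~~ is_aff P -> ~~ is_aff (f P).
Proof.
move=> H; apply: contra; case E: (f P) => [a b||] // _.
by have [x [y E']] := H a b; move: E; rewrite -E' => /perm_inj ->.
Qed.

Lemma affine_onto z c u : c != 0 -> exists x, x ** c + u = z.
Proof. by move=> /(nf_divr (z - u))[x E]; exists x; rewrite E subrK. Qed.

Lemma line_through P : ~~ is_aff P ->
  exists l x y x' y', [/\ PtAff x y != PtAff x' y', incident q P l,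
    incident q (PtAff x y) l & incident q (PtAff x' y') l].
Proof.
case: P => [x y|n|] // _.
- exists (LnGen (- n) 0), 0, 0, 1, n.
  rewrite !incidentE nf_mul0r nf_mul1r !addr0 addNr eqxx; split => //.
  by apply/eqP => -[/esym/eqP]; rewrite oner_eq0.
- exists (LnVert 0), 0, 0, 0, 1.
  rewrite !incidentE !addr0 eqxx; split => //.
  by apply/eqP => -[/esym/eqP]; rewrite oner_eq0.
Qed.

Lemma is_phi_inj c d u v f g : is_phi q c d u v f -> is_phi q c d u v g -> f = g.
Proof.
move=> /and4P[c0 d0 fc fE] /and4P[_ _ gc gE].
have affE k : [forall x, forall y, k (PtAff x y) == PtAff (x ** c + u) (y ** d + v)] ->
    forall x y, k (PtAff x y) = PtAff (x ** c + u) (y ** d + v).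
  by move=> H x y; apply/eqP; move/forallP: H => /(_ x)/forallP/(_ y).
have {}fE := affE _ fE; have {}gE := affE _ gE.
have onto k : (forall x y, k (PtAff x y) = PtAff (x ** c + u) (y ** d + v)) ->
    forall a b, exists x y, k (PtAff x y) = PtAff a b.
  move=> kE a b; have [x <-] := affine_onto a u c0; have [y <-] := affine_onto b v d0.
  by exists x, y.
have fE' := onto _ fE; have gE' := onto _ gE.
apply/permP => P; case: (boolP (is_aff P)) => [|naff].
  by case: P => // x y _; rewrite fE gE.
have [l [x [y [x' [y' [neq Pl xyl xyl']]]]]] := line_through naff.
have [m mE] := (collineationP _ fc) l; have [m' mE'] := (collineationP _ gc) l.
have fx1 : incident q (f (PtAff x y)) m by rewrite mE.
have fx2 : incident q (f (PtAff x' y')) m by rewrite mE.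
have mm : m = m'.
  have gx1 : incident q (g (PtAff x y)) m' by rewrite mE'.
  have gx2 : incident q (g (PtAff x' y')) m' by rewrite mE'.
  move: fx1 fx2 gx1 gx2; rewrite !fE !gE; apply: aff_line_uniq.
  by rewrite -!fE (inj_eq (@perm_inj _ f)).
apply: (@inf_point_uniq _ _ m).
- by apply/eqP => mI; move: fx1; rewrite mI fE incidentE.
- exact: nonaff_stable.
- exact: nonaff_stable.
- by rewrite mE.
- by rewrite mm mE'.
Qed.

(** * The group of the unital *)

Variable U : {set np_point F}.
Hypotheses (U_unital : is_unital q U) (U_vert : PtVert \in U) (U_origin : PtAff 0 0 \in U).
Hypothesis U_tangent : exists2 l : np_line F,
  tangent_at q U (PtAff 0 0) l & incident q (PtInf 0) l.
Hypothesis cardG : #|grpG q U| = (q * (q ^ 2).-1)%N.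

Lemma tangent_origin : #|U :&: line_points q (LnGen 0 0)| = 1%N.
Proof.
case: U_tangent => -[s t|t|] [_ I0 c1] I1; move: I0 I1; rewrite !incidentE //.
rewrite nf_mul0r !add0r addr0 => /eqP t0 /eqP s0; by rewrite s0 t0 in c1.
Qed.

Lemma tangent_origin_uniq P : P \in U -> incident q P (LnGen 0 0) -> P = PtAff 0 0.
Proof.
move=> PU Pl; have /eqP/cards1P[Q E] := tangent_origin.
have : P \in [set Q] by rewrite -E !inE PU.
have : PtAff 0 0 \in [set Q] by rewrite -E !inE U_origin incidentE nf_mulr0 !addr0 eqxx.
by move=> /set1P -> /set1P ->.
Qed.

Lemma tangent_aff x : PtAff x 0 \in U -> x = 0.
Proof.
move=> xU; suff [-> //] : PtAff x 0 = PtAff 0 0.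
by apply: tangent_origin_uniq; rewrite ?incidentE ?nf_mulr0 ?addr0.
Qed.

Lemma inf0_notin : PtInf 0 \notin U.
Proof.
by apply/negP => /tangent_origin_uniq; rewrite incidentE addr0 eqxx => /(_ isT).
Qed.

Lemma grpG_U f P : f \in grpG q U -> (f P \in U) = (P \in U).
Proof.
move=> /setIP[/setIdP[_ /eqP fU] _].
by rewrite -[in LHS]fU (mem_imset _ _ (@perm_inj _ f)).
Qed.

Lemma grpG_phi f : f \in grpG q U -> exists c d u v, is_phi q c d u v f.
Proof.
move=> fG; case/setIP: (fG) => _ /setUP[]; rewrite inE.
  by move=> /existsP[c /existsP[d /existsP[u /existsP[v H]]]]; exists c, d, u, v.
move=> /existsP[c /existsP[d /existsP[u /existsP[v /and4P[c0 d0 fc /forallP H]]]]].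
have fE x y : f (PtAff x y) = PtAff (y ** c + u) (x ** d + v).
  by apply/eqP; have /forallP/(_ y) := H x.
have nf : ~~ is_aff (f PtVert).
  apply: nonaff_stable => // a b.
  have [y ya] := affine_onto a u c0; have [x xb] := affine_onto b v d0.
  by exists x, y; rewrite fE ya xb.
have [m mE] := (collineationP _ fc) (LnVert 0).
have mL : m = LnGen 0 (- v).
  apply: (@aff_line_uniq u v (c + u) v).
  - by apply/eqP => -[/esym/eqP]; rewrite -subr_eq0 addrK (negPf c0).
  - have := mE (PtAff 0 0); rewrite fE !nf_mul0r !add0r => ->.
    by rewrite incidentE addr0.
  - have := mE (PtAff 0 1); rewrite fE !nf_mul0r nf_mul1r !add0r => ->.
    by rewrite incidentE addr0.
  - by rewrite incidentE nf_mulr0 add0r subrr.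
  - by rewrite incidentE nf_mulr0 add0r subrr.
have := mE PtVert; rewrite incidentE mL => fm.
have E : f PtVert = PtInf 0.
  apply: (inf_point_uniq _ nf _ fm) => //.
  by rewrite incidentE addr0.
by have := inf0_notin; rewrite -E (grpG_U _ fG) U_vert.
Qed.

(* For f = phi(c, d, u, v), the parameters are read off the images of (0, 0, 1)
   and (1, 1, 1). *)
Definition aff_x P := if P is PtAff x _ then x else 0.
Definition aff_y P := if P is PtAff _ y then y else 0.
Definition parU f := aff_x (f (PtAff 0 0)).
Definition parV f := aff_y (f (PtAff 0 0)).
Definition parC f := aff_x (f (PtAff 1 1)) - parU f.
Definition parD f := aff_y (f (PtAff 1 1)) - parV f.

Arguments parU f%_g.
Arguments parV f%_g.
Arguments parC f%_g.
Arguments parD f%_g.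

Lemma is_phiE c d u v f : is_phi q c d u v f ->
  forall x y, f (PtAff x y) = PtAff (x ** c + u) (y ** d + v).
Proof.
move=> /and4P[_ _ _ /forallP H] x y.
by apply/eqP; have /forallP/(_ y) := H x.
Qed.

Lemma is_phi_par c d u v f : is_phi q c d u v f ->
  [/\ parC f = c, parD f = d, parU f = u & parV f = v].
Proof.
move=> /is_phiE fE; rewrite /parC /parD /parU /parV !fE /=.
by rewrite !nf_mul0r !nf_mul1r !add0r !addrK.
Qed.

Lemma grpG_is_phi f : f \in grpG q U -> is_phi q (parC f) (parD f) (parU f) (parV f) f.
Proof.
by move=> /grpG_phi[c [d [u [v H]]]]; have [-> -> -> ->] := is_phi_par H.
Qed.

Lemma grpGE f x y : f \in grpG q U ->
  f (PtAff x y) = PtAff (x ** parC f + parU f) (y ** parD f + parV f).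
Proof. by move=> /grpG_is_phi/is_phiE. Qed.

Lemma parC_neq0 f : f \in grpG q U -> parC f != 0.
Proof. by move=> /grpG_is_phi/and4P[]. Qed.

Lemma parD_neq0 f : f \in grpG q U -> parD f != 0.
Proof. by move=> /grpG_is_phi/and4P[]. Qed.

Lemma grpG_inj f g : f \in grpG q U -> g \in grpG q U ->
  parC f = parC g -> parD f = parD g -> parU f = parU g -> parV f = parV g -> f = g.
Proof.
move=> fG gG E1 E2 E3 E4; apply: is_phi_inj (grpG_is_phi fG) _.
by rewrite E1 E2 E3 E4 grpG_is_phi.
Qed.

Lemma is_phi1 : is_phi q (1 : F) 1 0 0 1%g.
Proof.
apply/and4P; split; rewrite ?oner_eq0 //.
  by apply/collineationP => l; exists l => P; rewrite perm1.
by apply/forallP => x; apply/forallP => y; rewrite perm1 !nf_mulr1 !addr0.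
Qed.

Lemma is_phiM c d u v c' d' u' v' f g :
  is_phi q c d u v f -> is_phi q c' d' u' v' g ->
  is_phi q (c ** c') (d ** d') (u ** c' + u') (v ** d' + v') (f * g)%g.
Proof.
move=> fP gP; have fE := is_phiE fP; have gE := is_phiE gP.
move: fP gP => /and4P[c0 d0 fc _] /and4P[c0' d0' gc _].
apply/and4P; split.
- by rewrite nf_mul_eq0 negb_or c0.
- by rewrite nf_mul_eq0 negb_or d0.
- apply/collineationP => l; have [m mE] := collineationP _ fc l.
  have [k kE] := collineationP _ gc m.
  by exists k => P; rewrite permM kE mE.
apply/forallP => x; apply/forallP => y; rewrite permM fE gE !nf_mulDl !nf_mulA !addrA.
exact: eqxx.
Qed.

Lemma grpG_group_set : group_set (grpG q U).
Proof.
apply/group_setP; split.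
- have /and4P[_ _ c1 _] := is_phi1.
  apply/setIP; split.
    apply/setIdP; split=> //; apply/eqP/setP => P.
    by rewrite -{1}(perm1 P) (mem_imset _ _ (@perm_inj _ 1%g)).
  apply/setUP; left; rewrite inE; apply/existsP; exists 1; apply/existsP; exists 1.
  by apply/existsP; exists 0; apply/existsP; exists 0; exact: is_phi1.
- move=> f g fG gG; have P := is_phiM (grpG_is_phi fG) (grpG_is_phi gG).
  apply/setIP; split; last first.
    by apply/setUP; left; rewrite inE; do 4![apply/existsP; eexists]; exact: P.
  apply/setIdP; split; first by have /and4P[] := P.
  apply/eqP/setP => Q; rewrite -{1}(permKV (f * g)%g Q) (mem_imset _ _ (@perm_inj _ _)).
  by rewrite -(grpG_U _ fG) -(grpG_U _ gG) -permM permKV.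
Qed.

Canonical grpG_group := Group grpG_group_set.
Local Notation G := (grpG q U).

Lemma parC1 : parC 1 = 1. Proof. by have [] := is_phi_par is_phi1. Qed.
Lemma parD1 : parD 1 = 1. Proof. by have [] := is_phi_par is_phi1. Qed.
Lemma parU1 : parU 1 = 0. Proof. by have [] := is_phi_par is_phi1. Qed.
Lemma parV1 : parV 1 = 0. Proof. by have [] := is_phi_par is_phi1. Qed.

Lemma parCM f g : f \in G -> g \in G -> parC (f * g) = parC f ** parC g.
Proof.
by move=> fG gG; have [] := is_phi_par (is_phiM (grpG_is_phi fG) (grpG_is_phi gG)).
Qed.

Lemma parDM f g : f \in G -> g \in G -> parD (f * g) = parD f ** parD g.
Proof.
by move=> fG gG; have [] := is_phi_par (is_phiM (grpG_is_phi fG) (grpG_is_phi gG)).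
Qed.

Lemma parUM f g : f \in G -> g \in G -> parU (f * g) = parU f ** parC g + parU g.
Proof.
by move=> fG gG; have [] := is_phi_par (is_phiM (grpG_is_phi fG) (grpG_is_phi gG)).
Qed.

Lemma parVM f g : f \in G -> g \in G -> parV (f * g) = parV f ** parD g + parV g.
Proof.
by move=> fG gG; have [] := is_phi_par (is_phiM (grpG_is_phi fG) (grpG_is_phi gG)).
Qed.

Lemma parCX f n : f \in G -> is_square (parC f) -> parC (f ^+ n) = parC f ^+ n.
Proof.
move=> fG S; elim: n => [|n IH]; first by rewrite parC1.
by rewrite expgSr parCM ?groupX // IH nf_mulE S -exprSr.
Qed.

Lemma parDX f n : f \in G -> is_square (parD f) -> parD (f ^+ n) = parD f ^+ n.
Proof.
move=> fG S; elim: n => [|n IH]; first by rewrite parD1.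
by rewrite expgSr parDM ?groupX // IH nf_mulE S -exprSr.
Qed.

Lemma parUX f n : f \in G -> parC f = 1 -> parU (f ^+ n) = parU f *+ n.
Proof.
move=> fG C1; elim: n => [|n IH]; first by rewrite parU1.
by rewrite expgSr parUM ?groupX // IH C1 nf_mulr1 -mulrSr.
Qed.

Lemma parVX f n : f \in G -> parD f = 1 -> parV (f ^+ n) = parV f *+ n.
Proof.
move=> fG D1; elim: n => [|n IH]; first by rewrite parV1.
by rewrite expgSr parVM ?groupX // IH D1 nf_mulr1 -mulrSr.
Qed.

Lemma nf_sq_square x : x != 0 -> is_square (x ** x).
Proof. by move=> x0; rewrite is_square_nf_mul // eqxx. Qed.

(** * Translations *)

Definition translations := [set f in G | (parC f == 1) && (parD f == 1)].
Local Notation T := translations.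

Lemma transP f : reflect [/\ f \in G, parC f = 1 & parD f = 1] (f \in T).
Proof.
by apply: (iffP setIdP) => [[fG /andP[/eqP-> /eqP->]]|[fG -> ->]]; rewrite ?eqxx.
Qed.

Lemma trans_group_set : group_set T.
Proof.
apply/group_setP; split; first by apply/transP; rewrite group1 parC1 parD1.
move=> f g /transP[fG fC fD] /transP[gG gC gD]; apply/transP.
by rewrite groupM // parCM // parDM // fC fD gC gD !nf_mulr1.
Qed.

Canonical trans_group := Group trans_group_set.

Lemma trans_subG : T \subset G.
Proof. by apply/subsetP => f /transP[]. Qed.

Lemma trans_exp f : f \in T -> (f ^+ p)%g = 1%g.
Proof.
move=> fT; have /transP[XG XC XD] : (f ^+ p)%g \in T by rewrite groupX.
move: fT => /transP[fG fC fD].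
have np x : x *+ p = 0 by rewrite -mulr_natr (pcharf0 charF) mulr0.
apply: grpG_inj => //; rewrite ?group1 ?XC ?XD ?parC1 ?parD1 //.
  by rewrite parUX // np parU1.
by rewrite parVX // np parV1.
Qed.

Lemma coprime_q : coprime q (q ^ 2).-1.
Proof.
have : coprime (q ^ 2) (q ^ 2).-1 by rewrite coprimenP // expn_gt0 (ltn_trans _ q_gt2).
by rewrite coprime_pexpl.
Qed.

Lemma trans_pgroup : (p.-group T)%g.
Proof.
apply/pgroupP => r r_prime /(Cauchy r_prime)[f fT fo].
have : (#[f]%g %| p)%N by rewrite order_dvdn trans_exp.
by rewrite fo dvdn_prime2.
Qed.

Lemma frob_eq1 x : x ^+ q = 1 -> x = 1.
Proof. by move=> E; rewrite -(frobK x) E expr1n. Qed.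

Lemma card_sylow (P : {group {perm np_point F}}) : (p.-Sylow(G) P)%g -> #|P| = q.
Proof.
move=> sylP.
have q0 : (0 < q)%N by rewrite (ltn_trans _ q_gt2).
have r0 : (0 < (q ^ 2).-1)%N by rewrite predq2E muln_gt0; have := q_gt2; lia.
rewrite (card_Hall sylP) cardG partnM //.
rewrite {1}q_def partnX part_pnat_id ?pnat_id // -q_def part_p'nat ?muln1 //.
rewrite p'natE //; apply/negP => pd.
have /eqP := coprime_q; have : (p %| gcdn q (q ^ 2).-1)%N.
  by rewrite dvdn_gcd pd q_def dvdn_exp.
by move=> + E; rewrite E dvdn1 => /eqP E1; move: p_odd p_prime; rewrite E1.
Qed.

Lemma sylow_sub_trans (P : {group {perm np_point F}}) : (p.-Sylow(G) P)%g -> P \subset T.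
Proof.
move=> sylP; have PG := pHall_sub sylP.
have cP := card_sylow sylP.
apply/subsetP => f fP; have fG := subsetP PG _ fP.
have fq : (f ^+ q = 1)%g by apply/eqP; rewrite -order_dvdn -cP order_dvdG.
have f2G : (f ^+ 2)%g \in G by rewrite groupX.
have f2q : ((f ^+ 2) ^+ q = 1)%g by rewrite -expgM mulnC expgM fq expg1n.
have f2T : (f ^+ 2)%g \in T.
  apply/transP; split => //; apply: frob_eq1.
    rewrite -parCX // ?f2q ?parC1 // expgS expg1 parCM //.
    by rewrite nf_sq_square ?parC_neq0.
  rewrite -parDX // ?f2q ?parD1 // expgS expg1 parDM //.
  by rewrite nf_sq_square ?parD_neq0.
have -> : f = ((f ^+ 2) ^+ (q.+1)./2)%g by rewrite -expgM mulnC halfq expgS fq mulg1.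
by rewrite groupX.
Qed.

Lemma card_trans : #|T| = q.
Proof.
have [P sylP] := Sylow_exists p (G : {group _}).
have PT := sylow_sub_trans sylP.
by rewrite (sub_pHall sylP trans_pgroup PT trans_subG) (card_sylow sylP).
Qed.

Lemma trans_conj f g : f \in T -> g \in G ->
  (f ^ g)%g \in T /\ parU (f ^ g)%g = parU f ** parC g /\ parV (f ^ g)%g = parV f ** parD g.
Proof.
move=> /transP[fG fC fD] gG.
have : (f ^ g)%g \in G by rewrite groupJ.
move: (f ^ g)%g (conjgC f g) => h E hG.
have hC : parC h = 1.
  have := congr1 parC E; rewrite !parCM // fC nf_mul1r => /esym.
  by rewrite -[RHS]nf_mulr1; apply: nf_mulIl; rewrite parC_neq0.
have hD : parD h = 1.
  have := congr1 parD E; rewrite !parDM // fD nf_mul1r => /esym.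
  by rewrite -[RHS]nf_mulr1; apply: nf_mulIl; rewrite parD_neq0.
split; first by apply/transP.
split.
  have := congr1 parU E; rewrite !parUM // hC nf_mulr1 addrC => /addrI.
  by move=> ->.
have := congr1 parV E; rewrite !parVM // hD nf_mulr1 addrC => /addrI.
by move=> ->.
Qed.

Lemma q_lt_sq : (q * q.-1 < q * (q ^ 2).-1)%N.
Proof.
have := q_gt2; rewrite predq2E => q2; rewrite ltn_pmul2l; last by lia.
by rewrite -[X in (X < _)%N]muln1 ltn_pmul2l; lia.
Qed.

(* A translation moving both coordinates would have its centralizer inside the
   group of translations, hence too large a conjugacy class. *)
Lemma trans_U0 f : f \in T -> parU f = 0.
Proof.
move=> fT; have /transP[fG fC fD] := fT.
apply/eqP/negPn/negP => u0.
have v0 : parV f != 0.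
  apply/negP => /eqP v0; case/negP: u0; apply/eqP; apply: tangent_aff.
  by have := grpG_U (PtAff 0 0) fG; rewrite U_origin grpGE // !nf_mul0r !add0r v0.
have sub1 : (f ^: G \subset T :\ 1)%g.
  apply/subsetP => h /imsetP[g gG ->]; have [hT [hU hV]] := trans_conj fT gG.
  apply/setD1P; split=> //; apply/eqP => h1; move: hU; rewrite h1 parU1 => /esym/eqP.
  by rewrite nf_mul_eq0 (negPf u0) (negPf (parC_neq0 gG)).
have sub2 : ('C_G[f] \subset T)%g.
  apply/subsetP => g /setIP[gG /cent1P cfg]; apply/transP; split => //.
    have [_ [hU _]] := trans_conj fT gG.
    apply: (nf_mulIl u0); rewrite -hU nf_mulr1.
    by rewrite conjgE -cfg mulKg.
  have [_ [_ hV]] := trans_conj fT gG.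
  apply: (nf_mulIl v0); rewrite -hV nf_mulr1.
  by rewrite conjgE -cfg mulKg.
have := subset_leq_card sub1; rewrite -index_cent1 => c1.
have := subset_leq_card sub2; rewrite card_trans => c2.
have := cardsD1 1%g T; rewrite group1 card_trans add1n => c3.
have := Lagrange (subsetIl G 'C[f])%g; rewrite cardG => c4.
have := q_lt_sq; rewrite -c4 ltnNge => /negP; apply.
by apply: leq_mul => //; rewrite (leq_trans c1) // c3.
Qed.

(** * Vertical lines *)

Definition fiber a : {set F} := [set y | PtAff a y \in U].
Local Notation V := (fiber 0).

Lemma card_line_vert a : #|U :&: line_points q (LnVert (- a))| = (#|fiber a|).+1.
Proof.
have -> : U :&: line_points q (LnVert (- a)) = PtVert |: [set PtAff a y | y in fiber a].
  apply/setP => P; rewrite in_setU1 in_setI [P \in line_points _ _]inE.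
  apply/andP/orP => [[PU]|[/eqP->|/imsetP[y yU ->]]].
  - case: P PU => [x y|n|] PU; rewrite incidentE //; last by left.
    by rewrite subr_eq0 => /eqP xa; right; rewrite xa imset_f // inE -xa.
  - by rewrite U_vert incidentE.
  - by rewrite inE in yU; rewrite yU incidentE subrr.
rewrite cardsU1 card_imset; last by move=> y y' [].
by case: imsetP => // -[].
Qed.

Lemma card_fiber a : #|fiber a| = 0%N \/ #|fiber a| = q.
Proof.
by have [_ /(_ (LnVert (- a)))] := U_unital; rewrite card_line_vert => -[[->]|[->]]; auto.
Qed.

Lemma card_fiber0 : #|V| = q.
Proof.
case: (card_fiber 0) => // /eqP; rewrite cards_eq0 => /eqP E.
have : (0 : F) \in V by rewrite inE.
by rewrite E inE.
Qed.

Lemma trans_fiber f : f \in T -> parV f \in V.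
Proof.
move=> fT; have /transP[fG _ _] := fT.
have := grpG_U (PtAff 0 0) fG; rewrite U_origin grpGE // !nf_mul0r !add0r trans_U0 //.
by rewrite inE.
Qed.

Lemma fiber_trans v : v \in V -> exists2 f, f \in T & parV f = v.
Proof.
have inj : {in T &, injective parV}.
  move=> f g fT gT E; have /transP[fG fC fD] := fT; have /transP[gG gC gD] := gT.
  by apply: grpG_inj; rewrite // ?fC ?fD // !trans_U0.
have <- : parV @: T = V.
  apply/eqP; rewrite eqEcard card_in_imset // card_trans card_fiber0 leqnn andbT.
  by apply/subsetP => w /imsetP[f fT ->]; exact: trans_fiber.
by move=> /imsetP[f fT ->]; exists f.
Qed.

Lemma fiber_addE x y v : v \in V -> (PtAff x (y + v) \in U) = (PtAff x y \in U).
Proof.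
move=> /fiber_trans[f fT <-]; have /transP[fG fC fD] := fT.
by rewrite -(grpG_U (PtAff x y) fG) grpGE // fC fD !nf_mulr1 trans_U0 // addr0.
Qed.

Lemma fiber_add v w : v \in V -> w \in V -> v + w \in V.
Proof. by move=> vV wV; rewrite inE fiber_addE //; rewrite inE in vV. Qed.

Lemma fiber_0 : 0 \in V.
Proof. by rewrite inE. Qed.

Lemma fiber_opp v : v \in V -> - v \in V.
Proof. by move=> vV; rewrite inE -(fiber_addE _ _ vV) addNr. Qed.

Lemma fiber_muln v n : v \in V -> v *+ n \in V.
Proof.
move=> vV; elim: n => [|n IH]; first by rewrite mulr0n fiber_0.
by rewrite mulrSr fiber_add.
Qed.

Lemma card_fibers (I J : finType) (A : {set I}) (h : I -> J) :
  #|A| = (\sum_j #|[set z in A | h z == j]|)%N.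
Proof.
rewrite -sum1_card (partition_big h xpredT) //=; apply: eq_bigr => j _.
by rewrite -sum1_card; apply: eq_bigl => z; rewrite inE.
Qed.

Lemma card_const_fibers (I J : finType) (A : {set I}) (h : I -> J) n :
  (forall j, #|[set z in A | h z == j]| = 0%N \/ #|[set z in A | h z == j]| = n) ->
  #|A| = (#|[set j | [exists z in A, h z == j]]| * n)%N.
Proof.
move=> H; rewrite (card_fibers A h).
rewrite -sum_nat_const [RHS]big_mkcond /=; apply: eq_bigr => j _; rewrite inE.
case: (boolP [exists z in A, h z == j]) => [/existsP[z /andP[zA zj]]|nex].
  case: (H j) => // /eqP; rewrite cards_eq0 => /eqP/setP/(_ z).
  by rewrite !inE zA zj.
apply/eqP; rewrite cards_eq0; apply/eqP/setP => z; rewrite !inE.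
by apply: contraNF nex => zP; apply/existsP; exists z.
Qed.

Definition affU : {set F * F} := [set z | PtAff z.1 z.2 \in U].

Lemma card_affU : (#|affU| + #|U :&: line_points q LnInf| = (q ^ 3).+1)%N.
Proof.
have [<- _] := U_unital; rewrite -(cardsID (line_points q LnInf) U) addnC; congr addn.
have <- : [set PtAff z.1 z.2 | z in affU] = U :\: line_points q LnInf.
  apply/setP => P; rewrite in_setD [P \in line_points _ _]inE.
  apply/imsetP/andP => [[z zU ->]|[Pl PU]].
    by rewrite incidentE; rewrite inE in zU.
  by case: P Pl PU => [x y|n|]; rewrite incidentE // => _ PU; exists (x, y); rewrite ?inE.
by rewrite card_imset // => -[x y] [x' y'] /= [-> ->].
Qed.

Lemma card_slope (m t : F) : PtInf m \in U ->
  #|U :&: line_points q (LnGen (- m) t)| =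
  (#|[set z in affU | - (z.1 ** (- m) + z.2) == t]|).+1.
Proof.
move=> mU; set A := [set z in _ | _].
have -> : U :&: line_points q (LnGen (- m) t) = PtInf m |: [set PtAff z.1 z.2 | z in A].
  apply/setP => P; rewrite in_setU1 in_setI [P \in line_points _ _]inE.
  apply/andP/orP => [[PU]|[/eqP->|/imsetP[z zA ->]]].
  - case: P PU => [x y|n|] PU; rewrite incidentE //.
      move=> E; right; apply/imsetP; exists (x, y) => //.
      by rewrite !inE PU /= eq_sym -addr_eq0 addrC.
    by rewrite addrC subr_eq0 => /eqP ->; left.
  - by rewrite mU incidentE addNr.
  - move: zA; rewrite !inE => /andP[zU E]; rewrite zU; split => //.
    by rewrite incidentE addrC addr_eq0 eq_sym.
rewrite cardsU1 card_imset; last by move=> [x y] [x' y'] /= [-> ->].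
by case: imsetP => // -[].
Qed.

(* If the line at infinity were a secant, exactly one of the affine lines through
   a point PtInf m of U would meet U only there; but the translations of U
   permute these lines without a fixed one. *)
Lemma tangent_infinity : #|U :&: line_points q LnInf| = 1%N.
Proof.
have [_ /(_ LnInf)[//|c]] := U_unital.
have q2 := q_gt2.
have [m mU] : exists m : F, PtInf m \in U.
  have : (0 < #|(U :&: line_points q LnInf) :\ PtVert|)%N.
    have vI : PtVert \in U :&: line_points q LnInf.
      by rewrite in_setI U_vert [_ \in _]inE incidentE.
    have := cardsD1 PtVert (U :&: line_points q LnInf); rewrite vI c add1n => -[<-].
    by rewrite (ltn_trans _ q2).
  move=> /card_gt0P[P /setD1P[nv /setIP[PU]]]; rewrite inE.
  by case: P nv PU => [x y|n|] // _ PU; rewrite incidentE // => _; exists n.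
pose h (z : F * F) := - (z.1 ** (- m) + z.2).
have fib t : #|[set z in affU | h z == t]| = 0%N \/ #|[set z in affU | h z == t]| = q.
  have [_ /(_ (LnGen (- m) t))] := U_unital; rewrite card_slope //.
  by case=> -[E]; [left | right].
have := card_const_fibers fib; set E := [set j | _] => cE.
have := card_affU; rewrite c cE => cE2.
have cE3 : #|E| = (q ^ 2).-1.
  have q3 : (q ^ 3 = q ^ 2 * q)%N by rewrite -expnSr.
  apply/eqP; rewrite -(eqn_pmul2r (_ : 0 < q)%N); last by lia.
  by apply/eqP; move: cE2; rewrite q3 -mulnn -subn1 mulnBl; lia.
have := cardsC E; rewrite cE3 cardF => cE4.
have cE5 : #|~: E| = 1%N.
  apply/eqP; rewrite -(eqn_add2l (q ^ 2).-1) cE4 addn1 prednK //.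
  by rewrite expn_gt0 (ltn_trans _ q2).
move/eqP: cE5 => /cards1P[t0 Et0].
have [v vV v0] : exists2 v, v \in V & v != 0.
  have : (0 < #|V :\ 0%R|)%N.
    have := cardsD1 0 V; rewrite card_fiber0 fiber_0 add1n => E0.
    by move: q2; rewrite E0 ltnS; exact: leq_trans.
  by move=> /card_gt0P[v /setD1P[v0 vV]]; exists v.
have : t0 + v \in ~: E.
  have : t0 \in ~: E by rewrite Et0 inE.
  rewrite !inE; apply: contra => /existsP[[x y] /andP[xyU /eqP E0]].
  apply/existsP; exists (x, y + v); rewrite inE /= fiber_addE //.
  by rewrite inE /= in xyU; rewrite xyU /= /h /= addrA opprD -[X in X - v]/(h (x, y)) E0 addrK.
by rewrite Et0 inE -subr_eq0 addrAC subrr add0r (negPf v0).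
Qed.

Lemma card_fiber_q a : #|fiber a| = q.
Proof.
have fib b : #|[set z in affU | z.1 == b]| = #|fiber b|.
  have -> : [set z in affU | z.1 == b] = [set (b, y) | y in fiber b].
    apply/setP => -[x y]; rewrite !inE /=; apply/andP/imsetP => [[xyU /eqP <-]|].
      by exists y; rewrite ?inE.
    by move=> [y']; rewrite inE => yU [-> ->]; rewrite yU eqxx.
  by rewrite card_imset // => y y' [].
have fib0q b : #|[set z in affU | z.1 == b]| = 0%N \/ #|[set z in affU | z.1 == b]| = q.
  by rewrite fib; exact: card_fiber.
have := card_const_fibers fib0q; set E := [set j | _] => cE.
have q2 := q_gt2.
have : #|E| = #|F|.
  have := card_affU; rewrite tangent_infinity cE addn1 => -[].
  have q3 : (q ^ 3 = q ^ 2 * q)%N by rewrite -expnSr.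
  by rewrite q3 cardF => /eqP; rewrite eqn_pmul2r; [move/eqP | lia].
move=> /eqP cET; have : a \in E.
  have -> : E = setT by apply/eqP; rewrite eqEcard subsetT cardsT (eqP cET) leqnn.
  by rewrite inE.
rewrite inE => /existsP[[x y] /andP[xyU /eqP /= xa]].
case: (card_fiber a) => // /eqP; rewrite cards_eq0 => /eqP E0.
have : y \in fiber a by rewrite inE -xa; rewrite inE in xyU.
by rewrite E0 inE.
Qed.

Lemma fiber_coset a b y : PtAff a b \in U -> (PtAff a y \in U) = (y - b \in V).
Proof.
move=> bU.
have -> : (PtAff a y \in U) = (y \in fiber a) by rewrite inE.
have <- : [set b + v | v in V] = fiber a.
  apply/eqP; rewrite eqEcard card_fiber_q card_imset ?card_fiber0 ?leqnn ?andbT; last exact: addrI.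
  by apply/subsetP => z /imsetP[v vV ->]; rewrite inE fiber_addE.
apply/imsetP/idP => [[v vV ->]|yV]; first by rewrite addrC addKr.
by exists (y - b) => //; rewrite addrC subrK.
Qed.

Lemma fiber_neq0 a b : a != 0 -> PtAff a b \in U -> b \notin V.
Proof.
move=> a0 bU; apply/negP => /fiber_opp bV; case/negP: a0; apply/eqP; apply: tangent_aff.
by rewrite (fiber_coset _ bU) sub0r.
Qed.

Lemma fiber_ex a : exists b, PtAff a b \in U.
Proof.
have : (0 < #|fiber a|)%N by rewrite card_fiber_q (ltn_trans _ q_gt2).
by move=> /card_gt0P[b bU]; exists b; rewrite inE in bU.
Qed.

(** * The multipliers of the group *)

Lemma grpG_fix_origin f : f \in G -> parU f = 0 ->
  exists g, [/\ g \in G, parC g = parC f, parD g = parD f, parU g = 0 & parV g = 0].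
Proof.
move=> fG u0.
have vV : parV f \in V.
  have := grpG_U (PtAff 0 0) fG.
  by rewrite U_origin grpGE // !nf_mul0r !add0r u0 inE.
have [t tT tv] := fiber_trans (fiber_opp vV); have /transP[tG tC tD] := tT.
exists (f * t)%g; split; first by rewrite groupM.
- by rewrite parCM // tC nf_mulr1.
- by rewrite parDM // tD nf_mulr1.
- by rewrite parUM // u0 nf_mul0r trans_U0 // addr0.
- by rewrite parVM // tD nf_mulr1 tv subrr.
Qed.

Lemma muln_q x : x *+ q = 0.
Proof. by rewrite -mulr_natr q_natr mulr0. Qed.

(* For a square d <> 1 the orbit sum of b under multiplication by d vanishes,
   while each of its q ^ 2 - 1 terms is in b + V. *)
Lemma fix_vert_square f : f \in G -> parC f = 1 -> parU f = 0 ->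
  is_square (parD f) -> parD f = 1.
Proof.
move=> fG fC fU fS; have [g [gG gC gD gU gV]] := grpG_fix_origin fG fU.
apply/eqP/negPn/negP => d1; rewrite fC in gC.
have [b bU] := fiber_ex 1.
have bV : b \notin V by apply: fiber_neq0 bU; exact: oner_neq0.
set d := parD f in fS d1 gD.
have orb k : PtAff 1 (b * d ^+ k) \in U.
  elim: k => [|k IH]; first by rewrite mulr1.
  rewrite exprSr mulrA -(grpG_U (PtAff 1 (b * d ^+ k)) gG) in IH *.
  by move: IH; rewrite grpGE // gC gU gV gD !nf_mulr1 !addr0 nf_mulE fS.
have : \sum_(k < (q ^ 2).-1) (b * d ^+ k - b) \in V.
  apply: (big_ind (fun x => x \in V)); first exact: fiber_0.
    exact: fiber_add.
  by move=> k _; rewrite -(fiber_coset _ bU).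
rewrite sumrB -mulr_sumr sumr_const card_ord.
have -> : \sum_(k < (q ^ 2).-1) d ^+ k = 0.
  have /eqP := subrX1 d (q ^ 2).-1; rewrite expf_predq2 ?parD_neq0 // subrr eq_sym mulf_eq0.
  by rewrite subr_eq0 (negPf d1) => /eqP.
have -> : b *+ (q ^ 2).-1 = - b.
  apply/eqP; rewrite -addr_eq0 -mulrSr prednK ?expn_gt0 ?(ltn_trans _ q_gt2) //.
  by rewrite -mulnn mulrnA muln_q.
by rewrite mulr0 sub0r opprK (negPf bV).
Qed.

Lemma fix_vert f : f \in G -> parC f = 1 -> parU f = 0 -> parD f = 1.
Proof.
move=> fG fC fU; have [g [gG gC gD gU gV]] := grpG_fix_origin fG fU.
rewrite -gD; rewrite fC in gC.
have dd : parD g ** parD g = 1.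
  rewrite -parDM //; apply: fix_vert_square; rewrite ?groupM //.
  - by rewrite parCM // gC nf_mulr1.
  - by rewrite parUM // gU nf_mul0r addr0.
  - by rewrite parDM // nf_sq_square // parD_neq0.
have [b bU] := fiber_ex 1.
have bV : b \notin V by apply: fiber_neq0 bU; exact: oner_neq0.
set d := parD g in dd *.
have [//|d1] := eqVneq d 1.
have b2 : b + b ** d = 0.
  apply/eqP/negPn/negP => s0; case/eqP: d1; apply: (nf_mulIl s0).
  by rewrite nf_mulr1 nf_mulDl nf_mulA dd nf_mulr1 addrC.
have : PtAff 1 (b ** d) \in U.
  have := grpG_U (PtAff 1 b) gG.
  by rewrite bU grpGE // gC gU gV nf_mulr1 !addr0.
rewrite (fiber_coset _ bU); have -> : b ** d = - b by apply/eqP; rewrite -addr_eq0 addrC b2.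
rewrite -opprD => /fiber_opp; rewrite opprK -mulr2n => /(fiber_muln (q.+1)./2).
by rewrite -mulrnA mulnC halfq mulrSr muln_q add0r (negPf bV).
Qed.

Lemma parC1_trans f : f \in G -> parC f = 1 -> f \in T.
Proof.
have sq g : g \in G -> parC g = 1 -> is_square (parD g) -> g \in T.
  move=> gG gC gS; apply/transP; split=> //; apply: frob_eq1; rewrite -parDX //.
  apply: fix_vert; rewrite ?groupX //; last by rewrite parUX // muln_q.
  by rewrite parCX // gC ?is_square1 // expr1n.
move=> fG fC; apply/transP; split=> //; apply: fix_vert => //.
have /trans_U0 : (f * f)%g \in T.
  apply: sq; rewrite ?groupM //; first by rewrite parCM // fC nf_mulr1.
  by rewrite parDM // nf_sq_square ?parD_neq0.
rewrite parUM // fC nf_mulr1 -mulr2n -mulr_natr => /eqP.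
by rewrite mulf_eq0 (negPf two_neq0) orbF => /eqP.
Qed.

Lemma parC_eq f g : f \in G -> g \in G -> parC f = parC g -> (f * g^-1)%g \in T.
Proof.
move=> fG gG E; have hG : (f * g^-1)%g \in G by rewrite groupM ?groupV.
apply: parC1_trans => //; apply: (nf_mulIr (parC_neq0 gG)).
by rewrite -parCM // mulgKV nf_mul1r.
Qed.

Lemma parU_eq f g : f \in G -> g \in G -> parC f = parC g -> parU f = parU g.
Proof.
move=> fG gG E; have hT := parC_eq fG gG E; have /transP[hG hC hD] := hT.
by rewrite -[f](mulgKV g) parUM // trans_U0 // nf_mul0r add0r.
Qed.

Lemma parC_onto c : c != 0 -> exists2 f, f \in G & parC f = c.
Proof.
move=> c0.
have fib a : #|[set f in G | parC f == a]| = 0%N \/ #|[set f in G | parC f == a]| = q.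
  have [->|/set0Pn[g /setIdP[gG /eqP ga]]] := eqVneq [set f in G | parC f == a] set0.
    by left; rewrite cards0.
  right; rewrite -[RHS]card_trans -[RHS](card_rcoset _ g); apply: eq_card => f.
  rewrite [RHS]mem_rcoset; apply/setIdP/idP => [[fG /eqP fa]|hT].
    by apply: (parC_eq fG gG); rewrite ga.
  have /transP[hG hC hD] := hT.
  by rewrite -[f](mulgKV g) groupM // parCM // hC ga nf_mul1r eqxx.
have := card_const_fibers fib; set E := [set j | _]; rewrite cardG => cE.
have : c \in E.
  suff -> : E = [set~ 0] by rewrite !inE.
  apply/eqP; rewrite eqEcard cardsC1 cardF; apply/andP; split.
    apply/subsetP => a; rewrite inE => /existsP[f /andP[fG /eqP <-]].
    by rewrite !inE parC_neq0.
  by rewrite -(leq_pmul2r (_ : 0 < q)%N) ?(ltn_trans _ q_gt2) // -cE mulnC.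
by rewrite inE => /existsP[f /andP[fG /eqP fc]]; exists f.
Qed.

Lemma Fq_N1 : -1 \in Fq F q.
Proof. by rewrite Fq_opp ?Fq1. Qed.

Lemma card_G_gt : (q ^ 2 < q * (q ^ 2).-1)%N.
Proof.
have q2 := q_gt2; rewrite -mulnn ltn_pmul2l; last by lia.
by rewrite mulnn predq2E; nia.
Qed.

(* An element z with x-part x |-> - x + u_z commutes with G up to translations,
   so 2 u_f = u_z - u_z ** c_f for all f; if u_z <> 0 only the identity would map
   the origin to a point of its tangent y = 0, and f |-> v_f would be injective. *)
Lemma grpG_U0 f : f \in G -> parU f = 0.
Proof.
have N1 : -1 != 0 :> F by rewrite oppr_eq0 oner_neq0.
have [z zG zC] := parC_onto N1.
have key g : g \in G -> parU z ** parC g + parU g = parU z - parU g.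
  move=> gG; rewrite -parUM // (@parU_eq _ (g * z)%g) ?groupM //.
    by rewrite parUM // zC nf_mul_Fq ?Fq_N1 // mulrN1 addrC.
  by rewrite !parCM // zC [in RHS]nf_mul_Fq ?Fq_N1 // nf_mulNl nf_mul1r mulrN1.
have z0 : parU z = 0.
  apply/eqP/negPn/negP => z0.
  have inj : {in G &, injective parV}.
    move=> g h gG hG E; have kG : (g * h^-1)%g \in G by rewrite groupM ?groupV.
    have kV : parV (g * h^-1) = 0.
      have := congr1 parV (mulgKV h g); rewrite parVM // E => /eqP.
      by rewrite -subr_eq0 addrK nf_mul_eq0 (negPf (parD_neq0 hG)) orbF => /eqP.
    have kU : parU (g * h^-1) = 0.
      apply: tangent_aff; have := grpG_U (PtAff 0 0) kG.
      by rewrite U_origin grpGE // !nf_mul0r !add0r kV.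
    have kC : parC (g * h^-1) = 1.
      by apply: (nf_mulIl z0); rewrite nf_mulr1; have := key _ kG; rewrite kU addr0 subr0.
    have /transP[_ _ kD] := parC1_trans kG kC.
    suff k1 : (g * h^-1 = 1)%g by rewrite -(mulgKV h g) k1 mul1g.
    by apply: grpG_inj; rewrite ?group1 ?parC1 ?parD1 ?parU1 ?parV1.
  have := max_card (mem (parV @: G)); rewrite card_in_imset // cardG cardF leqNgt.
  by rewrite card_G_gt.
move=> fG; have := key _ fG; rewrite z0 nf_mul0r !add0r => /eqP.
rewrite -addr_eq0 -mulr2n -mulr_natr mulf_eq0 (negPf two_neq0) orbF.
by move/eqP.
Qed.

Lemma domC_neq0 c : c != 0 -> c \in domC q U.
Proof.
move=> /parC_onto[f fG <-].
have [g [gG <- _ gU gV]] := grpG_fix_origin fG (grpG_U0 fG).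
rewrite inE; apply/existsP; exists (parD g); apply/existsP; exists g.
have P : is_phi q (parC g) (parD g) 0 0 g by have := grpG_is_phi gG; rewrite gU gV.
rewrite P andbT; apply/setIP; split => //; rewrite inE.
by apply/existsP; exists (parC g); apply/existsP; exists (parD g).
Qed.

Lemma delta_U c x y : c \in domC q U ->
  (PtAff (x ** c) (y ** delta q U c) \in U) = (PtAff x y \in U).
Proof.
rewrite inE => /existsP[d0 d0P]; rewrite /delta; case: pickP => [d|]; last first.
  by move=> /(_ d0); rewrite d0P.
move=> /existsP[f /andP[/setIP[fG _] fP]] /=.
by rewrite -(grpG_U (PtAff x y) fG) (is_phiE fP) !addr0.
Qed.

(** * Normal form *)

Definition square_delta j := forall x, x != 0 -> is_square x ->
  x \in domC q U /\ delta q U x = x ^+ (j * (q.+1)./2).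

Lemma Fq_square_exp x j : is_square x -> x ^+ (j * (q.+1)./2) \in Fq F q.
Proof.
move=> /existsP[z /eqP ->]; rewrite -exprM mulnC -mulnA halfq mulnC exprM.
by rewrite Fq_exp ?Nm_Fq.
Qed.

Lemma square_delta_U j x y z : square_delta j -> x != 0 -> is_square x ->
  PtAff z y \in U -> PtAff (z ** x) (y * x ^+ (j * (q.+1)./2)) \in U.
Proof.
move=> H x0 xS; have [xD <-] := H _ x0 xS; rewrite -(delta_U _ _ xD).
have [_ ->] := H _ x0 xS; by rewrite (nf_mul_Fq y) // Fq_square_exp.
Qed.

(* If gcd(j, q - 1) > 2, the line y = b through a point (1, b) of U contains the
   points (x, b) for more than q + 1 squares x. *)
Lemma square_delta_gcd j : square_delta j -> (gcdn j q.-1 %| 2)%N.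
Proof.
move=> H; have q2 := q_gt2; set g := gcdn j q.-1.
have g0 : (0 < g)%N by rewrite gcdn_gt0; apply/orP; right; lia.
suff : (g <= 2)%N by case: (g) g0 => [|[|[]]].
rewrite leqNgt; apply/negP => g3.
have [b bU] := fiber_ex 1.
have [k kE] : exists k, (q.-1 = k * g)%N by apply/dvdnP; exact: dvdn_gcdr.
have [i iE] : exists i, (j = i * g)%N by apply/dvdnP; exact: dvdn_gcdl.
pose x (m : 'I_q.+2) := xi ^+ (m * k * 2).
have xU (m : 'I_q.+2) : PtAff (x m) b \in U.
  have x0 : x m != 0 by rewrite expf_neq0 ?xi_neq0.
  have xS : is_square (x m) by rewrite is_squareX oddM andbF.
  have := square_delta_U H x0 xS bU; rewrite nf_mul1r /x -exprM.
  have -> : (m * k * 2 * (j * (q.+1)./2) = (q ^ 2).-1 * (m * i))%N.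
    by rewrite predq2E -[X in _ = (_ * X * _)%N]halfq kE iE; ring.
  by rewrite (exprM _ (q ^ 2).-1) expf_predq2 ?xi_neq0 // expr1n mulr1.
have x_inj : injective x.
  move=> m n /eqP; rewrite /x (eq_prim_root_expr xi_prim) predq2E kE.
  have lt (l : 'I_q.+2) : (l * k * 2 < k * g * q.+1)%N.
    have k0 : (0 < k)%N by case: (k) kE; lia.
    have -> : (l * k * 2 = k * (l * 2))%N by ring.
    rewrite -mulnA ltn_pmul2l //; have := ltn_ord l; rewrite ltnS => lq.
    have : (l * 2 <= q.+1 * 2)%N by rewrite leq_mul2r lq orbT.
    by move=> /leq_ltn_trans; apply; rewrite mulnC ltn_pmul2r.
  rewrite !modn_small // -!mulnA eqn_pmul2r; first by move=> /eqP /val_inj.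
  by rewrite muln_gt0 andbT; case: (k) kE; lia.
have sub : [set PtAff (x m) b | m : 'I_q.+2] \subset U :&: line_points q (LnGen 0 (- b)).
  apply/subsetP => P /imsetP[m _ ->]; rewrite in_setI xU inE incidentE.
  by rewrite nf_mulr0 add0r subrr eqxx.
have := subset_leq_card sub; rewrite card_imset ?card_ord; last by move=> m n [] /x_inj.
by have [_ /(_ (LnGen 0 (- b)))[->|->]] := U_unital; rewrite ?ltnn //; lia.
Qed.

Lemma Fq_sqr_exp j t : (gcdn j q.-1 %| 2)%N -> t \in Fq F q -> t != 0 ->
  exists2 s, s \in Fq F q & s != 0 /\ s ^+ j = t ^+ 2.
Proof.
move=> /dvdnP[k k2] tq t0; have q2 := q_gt2.
have q0 : (0 < q.-1)%N by lia.
have [a _ /dvdnP[i iE]] := Bezoutl j q0.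
exists ((t^-1) ^+ (a * k)); first by rewrite Fq_exp // Fq_inv.
split; first by rewrite expf_neq0 // invr_eq0.
have tq1 : t ^+ q.-1 = 1.
  apply: (mulfI t0); rewrite mulr1 -exprS prednK; last by lia.
  by rewrite FqX in tq; exact/eqP.
have E : t ^+ (a * k * j) * t ^+ 2 = 1.
  rewrite k2 -exprD gcdnC.
  have -> : (a * k * j + k * gcdn q.-1 j = q.-1 * (i * k))%N.
    by rewrite [RHS]mulnA [(q.-1 * i)%N]mulnC -iE; ring.
  by rewrite exprM tq1 expr1n.
rewrite -exprM exprVn; apply: (mulfI (_ : t ^+ (a * k * j) != 0)); first by rewrite expf_neq0.
by rewrite E divff // expf_neq0.
Qed.

Lemma fiber_Fq j v t : square_delta j -> v \in V -> t \in Fq F q -> v * t \in V.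
Proof.
move=> H vV; have g2 := square_delta_gcd H.
have sqV s : s \in Fq F q -> v * s ^+ 2 \in V.
  move=> sq; have [->|s0] := eqVneq s 0; first by rewrite expr0n mulr0 fiber_0.
  have [r rq [r0 <-]] := Fq_sqr_exp g2 sq s0.
  have [z z0 ->] := Fq_Nm r0 rq.
  have zS : is_square (z ^+ 2) by apply/existsP; exists z.
  have := square_delta_U H (_ : z ^+ 2 != 0) zS (_ : PtAff 0 v \in U).
  rewrite nf_mul0r -exprM mulnC -mulnA halfq mulnC exprM inE; apply.
    by rewrite expf_neq0.
  by rewrite inE in vV.
move=> tq.
have Fq2 : 2%:R \in Fq F q by rewrite -[2%:R]/(1 + 1) Fq_add ?Fq1.
have -> : v * t = v * ((t + 1) / 2%:R) ^+ 2 - v * ((t - 1) / 2%:R) ^+ 2.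
  by field; rewrite two_neq0.
by rewrite fiber_add // ?fiber_opp // sqV // Fq_mul ?Fq_inv // Fq_add ?Fq_opp ?Fq1.
Qed.

Lemma fiber_line j : square_delta j ->
  exists2 w, w != 0 & forall v, v \in V <-> exists2 t, t \in Fq F q & v = w * t.
Proof.
move=> H; have q2 := q_gt2.
have : (0 < #|V :\ 0%R|)%N.
  have := cardsD1 0 V; rewrite card_fiber0 fiber_0 add1n => E0.
  by move: q2; rewrite E0 ltnS; exact: leq_trans.
move=> /card_gt0P[w /setD1P[w0 wV]]; exists w => // v.
have <- : [set w * t | t in Fq F q] = V.
  apply/eqP; rewrite eqEcard card_imset ?card_fiber0 ?card_Fq ?andbT; last exact: mulfI.
  by apply/subsetP => y /imsetP[t tq ->]; exact: fiber_Fq H _ _.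
by split=> [/imsetP|] [t tq ->]; [exists t | exact: imset_f].
Qed.

Lemma normalizer j : square_delta j ->
  exists2 d, d != 0 & exists2 b, PtAff 1 b \in U &
    (exists2 s, s \in Fq F q & b ** d = 1 + s * eps) /\
    (forall v, v \in V <-> exists2 t, t \in Fq F q & v ** d = t * eps).
Proof.
move=> H; have [w w0 wV] := fiber_line H; have [b bU] := fiber_ex 1.
have bV : b \notin V by apply: fiber_neq0 bU; exact: oner_neq0.
have [d d_eps] := nf_divl eps w0.
have d0 : d != 0.
  by apply/eqP => d0; have := eps_neq0; rewrite -d_eps d0 nf_mulr0 eqxx.
have wd t : t \in Fq F q -> (w * t) ** d = t * eps.
  by move=> tq; rewrite nf_mul_Fql // d_eps mulrC.
have [s sq [t tq bE]] := Fq_eps_decomp (b ** d).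
have s0 : s != 0.
  apply/eqP => s0; move: bE; rewrite s0 add0r -wd // => /(nf_mulIr d0) E.
  by case/negP: bV; apply/wV; exists t.
have sVq := Fq_inv sq.
have E y : y ** (d / s) = (y ** d) / s by rewrite -(nf_mul_Fq d) // -nf_mulA nf_mul_Fq.
exists (d / s); first by rewrite mulf_neq0 ?invr_eq0.
exists b => //; split.
  exists (t / s); first exact: Fq_mul.
  by rewrite E bE mulrDl divff // mulrAC.
move=> v; rewrite E; split=> [/wV[r rq ->]|[r rq vE]].
  by exists (r / s); rewrite ?Fq_mul // wd // mulrAC.
apply/wV; exists (r * s); first exact: Fq_mul.
by apply: (nf_mulIr d0); rewrite wd ?Fq_mul // mulrAC -vE mulfVK.
Qed.

Lemma normalizer_point b d s k x y : s \in Fq F q -> k \in Fq F q ->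
  b ** d = 1 + s * eps ->
  (forall v, v \in V <-> exists2 t, t \in Fq F q & v ** d = t * eps) ->
  PtAff x (b * k) \in U ->
  PtAff x y \in U <-> exists2 t, t \in Fq F q & y ** d = k + t * eps.
Proof.
move=> sq kq bE VE xbU.
have -> : (PtAff x y \in U) = (y - b * k \in V) by apply: fiber_coset.
rewrite VE nf_mulBl nf_mul_Fql // bE; split=> -[t tq E].
  exists (s * k + t); first by rewrite Fq_add ?Fq_mul.
  by move/eqP: E; rewrite subr_eq => /eqP ->; ring.
exists (t - s * k); first by rewrite Fq_add ?Fq_opp ?Fq_mul.
by rewrite E; ring.
Qed.

Definition scale_fun d P :=
  match P with
  | PtAff x y => PtAff x (y ** d)
  | PtInf n => PtInf (n ** d)
  | PtVert => PtVert
  end.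

Lemma scale_inj d : d != 0 -> injective (scale_fun d).
Proof.
by move=> d0 [x y|n|] [x' y'|n'|] //= [] => [-> | ] /(nf_mulIr d0) ->.
Qed.

Lemma scale_collineation d (d0 : d != 0) : perm (scale_inj d0) \in collineations F q.
Proof.
apply/collineationP => l.
exists (match l with LnGen s t => LnGen (s ** d) (t ** d) | _ => l end) => P; rewrite permE.
case: l => [s t|t|]; case: P => [x y|n|] /=; rewrite !incidentE //.
  by rewrite -nf_mulA -!nf_mulDl nf_mul_eq0 (negPf d0) orbF.
by rewrite -nf_mulDl nf_mul_eq0 (negPf d0) orbF.
Qed.

Lemma inf_notin (n : F) : PtInf n \notin U.
Proof.
apply/negP => nU; have /eqP/cards1P[Q E] := tangent_infinity.
have : PtInf n \in [set Q] by rewrite -E in_setI nU inE incidentE.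
have : PtVert \in [set Q] by rewrite -E in_setI U_vert inE incidentE.
by move=> /set1P <- /set1P.
Qed.

Lemma proj_equiv_unitalU j : (0 < j)%N ->
  (forall x : F, x \in domC q U -> delta q U x = x ^+ (j * q.+1)) ->
  proj_equiv q U (unitalU q eps j).
Proof.
move=> j0 H.
have H2 : square_delta (j * 2).
  move=> x x0 _; split; first exact: domC_neq0.
  by rewrite H ?domC_neq0 // -mulnA [(2 * _)%N]mulnC halfq.
have [d d0 [b bU [[s sq bE] VE]]] := normalizer H2.
have NmE x : Nm q x ^+ j = x ^+ (j * q.+1) by rewrite /Nm -exprM mulnC.
have Nmq x : Nm q x ^+ j \in Fq F q by rewrite Fq_exp // Nm_Fq.
have curve x : PtAff x (b * Nm q x ^+ j) \in U.
  have [->|x0] := eqVneq x 0.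
    by rewrite NmE expr0n muln_eq0 orbF eqn0Ngt j0 mulr0.
  have := delta_U 1 b (domC_neq0 x0).
  by rewrite bU H ?domC_neq0 // -NmE nf_mul1r nf_mul_Fq.
exists (perm (scale_inj d0)); first exact: scale_collineation.
apply/setP => Q; apply/imsetP/setUP => [[P PU ->]|[]].
- rewrite permE; case: P PU => [x y|n|] /= PU; last by right; rewrite inE.
    left; have [t tq ->] := (normalizer_point _ sq (Nmq x) bE VE (curve x)).1 PU.
    by apply/imset2P; exists x t.
  by rewrite (negPf (inf_notin n)) in PU.
- move=> /imset2P[x t _ tq ->]; have [y yE] := nf_divr (Nm q x ^+ j + t * eps) d0.
  exists (PtAff x y); last by rewrite permE /= yE.
  by apply/(normalizer_point _ sq (Nmq x) bE VE (curve x)); exists t.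
- by move=> /set1P ->; exists PtVert; rewrite ?permE.
Qed.

Lemma setV_sub_proj_equiv j : square_delta j ->
  exists U' : {set np_point F},
    [/\ is_unital q U', proj_equiv q U U' & setV q eps j \subset U'].
Proof.
move=> H; have [d d0 [b bU [[s sq bE] VE]]] := normalizer H.
have fc := scale_collineation d0.
exists (perm (scale_inj d0) @: U); split.
- exact: unital_collineation.
- by exists (perm (scale_inj d0)).
apply/subsetP => Q /imset2P[x t]; rewrite inE => /andP[x0 xS] tq ->.
have curve := square_delta_U H x0 xS bU; rewrite nf_mul1r in curve.
have [y yE] := nf_divr (x ^+ (j * (q.+1)./2) + t * eps) d0.
apply/imsetP; exists (PtAff x y); last by rewrite permE /= yE.
by apply/(normalizer_point _ sq (Fq_square_exp j xS) bE VE curve); exists t.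
Qed.

End NearfieldPlane.

Theorem theorem9p4 (p e q : nat) (p_prime : prime p) (p_odd : odd p)
  (e_gt0 : (0 < e)%N) (q_def : q = (p ^ e)%N)
  (F : finFieldType) (cardF : #|F| = (q ^ 2)%N)
  (xi : F) (xi_prim : ((q ^ 2).-1).-primitive_root xi)
  (eps : F) (eps_def : eps = xi ^+ (q.+1)./2)
  (U : {set np_point F}) (U_unital : is_unital q U)
  (U_vert : PtVert \in U) (U_origin : PtAff 0 0 \in U)
  (U_tangent : exists2 l : np_line F,
     tangent_at q U (PtAff 0 0) l & incident q (PtInf 0) l)
  (cardG : #|grpG q U| = (q * (q ^ 2).-1)%N) :
  (forall j : nat, (0 < j)%N ->
     (forall x : F, x \in domC q U -> delta q U x = x ^+ (j * q.+1)) ->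
     proj_equiv q U (unitalU q eps j))
  /\
  (forall j : nat, (0 < j)%N ->
     (forall x : F, x != 0 -> is_square x ->
        x \in domC q U /\ delta q U x = x ^+ (j * (q.+1)./2)) ->
     exists U' : {set np_point F},
       [/\ is_unital q U', proj_equiv q U U' & setV q eps j \subset U']).
Proof.
split=> j j_gt0 H.
  by apply: (@proj_equiv_unitalU p e q _ _ _ q_def F cardF xi _ eps eps_def U).
by apply: (@setV_sub_proj_equiv p e q _ _ _ q_def F cardF xi _ eps eps_def U).
Qed.
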